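(* Let $\alpha>1$ and let $\{Z_k:k\in\mathbb Z\}$ be i.i.d. random variables on a probability space $(\Omega,\mathcal F,\mathbb P)$ with values in $[1,\infty)$ for which there are constants $a>0$ and $u_0>0$ with $\mathbb P[Z_1>u]=(a\,u)^{-\alpha}$ for all $u\ge u_0$. On the lattice $\mathbb Z^2$ with nearest-neighbour edges and canonical basis vectors $e_1,e_2$, consider the random conductances \[ \omega(x,y):=\begin{cases}1,&\text{if }x-y=\pm e_2,\\ Z_{x^2},&\text{if }x-y=\pm e_1,\end{cases} \] where $x^2$ denotes the second coordinate of $x=(x^1,x^2)\in\mathbb Z^2$. Then for $\delta\in(0,1)$ and $\mathbb P$-a.e. $\omega$ there exist $0<c_Z(\alpha,\delta)<C_Z(\alpha,\delta)<\infty$ and $L_0=L_0(\omega)<\infty$ such that for all $L\ge L_0$ ($L\in\mathbb N$), \[ c_Z\,(\ln L)^{-(1+\delta)/(2\alpha+1)}\,L^{2\alpha/(2\alpha+1)}\;\le\;d^\omega(0,Le_1)\;\le\;C_Z\,(\ln L)^{\delta/2\alpha}\,L^{2\alpha/(2\alpha+1)}. \]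
   Context: The chemical distance is $d^\omega(x,y):=\inf_\gamma\sum_{i=0}^{l_\gamma-1}1\wedge\omega(z_i,z_{i+1})^{-1/2}$, where the infimum is over all nearest-neighbour paths $\gamma=(z_0,\dots,z_{l_\gamma})$ in $\mathbb Z^2$ connecting $x$ and $y$, and $a\wedge b=\min\{a,b\}$. The constants $c_Z(\alpha,\delta),C_Z(\alpha,\delta)$ are deterministic; $L_0(\omega)$ may depend on $\omega$. The exponent $\delta/2\alpha$ means $\delta/(2\alpha)$. *)

(* Defs.v *)
From HB Require Import structures.
From mathcomp Require Export all_boot all_order all_algebra finmap.
From mathcomp Require Export all_classical all_reals all_analysis.

Set Implicit Arguments.
Unset Strict Implicit.
Unset Printing Implicit Defensive.

Import Order.TTheory GRing.Theory Num.Theory.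
Import numFieldNormedType.Exports.

Local Open Scope classical_set_scope.
Local Open Scope ring_scope.

Definition mutually_independent d (T : measurableType d) (R : realType)
    (P : probability T R) (I : choiceType) (X : I -> {RV P >-> R}) : Prop :=
  forall (J : {fset I}) (A : I -> set R), (forall i, measurable (A i)) ->
    P (\bigcap_(i in [set` J]) (X i @^-1` A i)) =
    (\prod_(i <- J) P (X i @^-1` A i))%E.

(* The two laws are compared on measurable sets only: the value of
   [distribution P X] elsewhere carries no information. *)
Definition identically_distributed d (T : measurableType d) (R : realType)
    (P : probability T R) (I : Type) (X : I -> {RV P >-> R}) : Prop :=
  forall (i j : I) (A : set R), measurable A ->
    distribution P (X i) A = distribution P (X j) A.

Notation Z2 := (int * int)%type.

Definition e1 : Z2 := (1, 0).
Definition e2 : Z2 := (0, 1).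

Definition neighbour : rel Z2 :=
  [rel x y | x - y \in [:: e1; - e1; e2; - e2]].

(* The value 0 off the nearest-neighbour edges is never used. *)
Definition layered_conductance (R : realType) (Z : int -> R) (x y : Z2) : R :=
  if x - y \in [:: e2; - e2] then 1
  else if x - y \in [:: e1; - e1] then Z x.2
  else 0.

Section ChemicalDistance.
Variables (R : realType) (c : Z2 -> Z2 -> R).

(* A path (z_0, ..., z_l) from x is given by x = z_0 and p = [:: z_1; ...; z_l]. *)
Definition path_cost (x : Z2) (p : seq Z2) : R :=
  let z := nth x (x :: p) in
  \sum_(i < size p) Num.min 1 (c (z i) (z i.+1) `^ (- 2^-1)).

(* The set is nonempty and bounded below by 0, so the real infimum is genuine.
   Conductances are meant to be positive on edges: [powR] sends 0 to 0 here. *)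
Definition chemical_distance (x y : Z2) : R :=
  inf [set path_cost x p | p in [set p | path neighbour x p /\ last x p = y]].

End ChemicalDistance.

(* Main.v *)
Require Import Defs.
From mathcomp Require Import all_boot all_order all_algebra finmap.
From mathcomp Require Import all_classical all_reals all_analysis.
From mathcomp Require Import ring lra zify.

Set Implicit Arguments.
Unset Strict Implicit.
Unset Printing Implicit Defensive.

Import Order.TTheory GRing.Theory Num.Theory.
Import numFieldNormedType.Exports.

(** Write M_N for the maximum of Z over the layers of height at most N. A path
from 0 to L e_1 that stays within height N makes at least L horizontal steps,
each of cost at least M_N^(-1/2); a path that leaves this strip pays at least N
for its vertical steps. Conversely, climbing to a layer of height at most N,
following it, and coming down costs at most 2 N + L Z_k^(-1/2), k being that
layer. Hence the distance is of the order of the value at which N and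
L M_N^(-1/2) balance ([chemical_distance_ge_layers],
[chemical_distance_le_layer]).

For the tail exponent alpha one has M_N close to N^(1/alpha), and the balance
is reached at N close to L^(2 alpha / (2 alpha + 1)). The logarithms come from
the almost sure control of M_N, needed only along N = 2^n since changing N by a
factor 2 changes the balance by a constant factor. A union bound shows that some layer exceeds the level of tail
probability 1 / (2^n n^(1+delta)) with probability O(n^(-(1+delta))). By
independence, no layer exceeds the level of tail probability n^delta / 2^n
with probability (1 - n^delta/2^n)^(2^n) <= exp(- n^delta). Both bounds are
summable in n, so by Borel-Cantelli neither event occurs for large n
([dyadic_maxima]). The remaining steps choose n, with 2^n comparable to
s = L^(2 alpha / (2 alpha + 1)) for the upper bound and to
s (ln L)^(-(1+delta)/(2 alpha + 1)) for the lower bound, and compute with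
powers ([balance_upper], [balance_lower]). *)

Local Open Scope classical_set_scope.
Local Open Scope ring_scope.

(** * Costs of nearest-neighbour paths *)

Section Paths.
Variables (R : realType) (c : Z2 -> Z2 -> R).

Definition edge_cost (x y : Z2) : R := Num.min 1 (c x y `^ (- 2^-1)).

Lemma edge_cost_ge0 x y : 0 <= edge_cost x y.
Proof. by rewrite le_min ler01 powR_ge0. Qed.

Lemma path_cost_nil x : path_cost c x [::] = 0.
Proof. by rewrite /path_cost big_ord0. Qed.

Lemma path_cost_cons x y p :
  path_cost c x (y :: p) = edge_cost x y + path_cost c y p.
Proof.
pose F n := edge_cost (nth x (x :: y :: p) n) (nth x (x :: y :: p) n.+1).
transitivity (\sum_(0 <= n < (size p).+1) F n); first by rewrite big_mkord.
rewrite big_nat_recl // big_mkord; congr (_ + _).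
apply: eq_bigr => i _; have ip := ltn_ord i; rewrite /F -/(edge_cost _ _).
congr edge_cost; last exact: set_nth_default.
by apply: (@set_nth_default _ (y :: p)); rewrite ltnS ltnW.
Qed.

Lemma path_cost_cat x p1 p2 :
  path_cost c x (p1 ++ p2) = path_cost c x p1 + path_cost c (last x p1) p2.
Proof.
elim: p1 x => [|y p1 IH] x; first by rewrite path_cost_nil add0r.
by rewrite cat_cons !path_cost_cons IH addrA.
Qed.

Lemma path_cost_ge0 x p : 0 <= path_cost c x p.
Proof.
elim: p x => [|y p IH] x; first by rewrite path_cost_nil.
by rewrite path_cost_cons addr_ge0 ?edge_cost_ge0.
Qed.

Lemma chemical_distance_le x y p :
  path neighbour x p -> last x p = y -> chemical_distance c x y <= path_cost c x p.
Proof.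
move=> xp xy; apply: ge_inf; last by exists p.
by exists 0 => _ [q _ <-]; exact: path_cost_ge0.
Qed.

Lemma straight_path (v : Z2) (b : R) n x :
  v \in [:: e1; - e1; e2; - e2] ->
  (forall i : nat, edge_cost (x + v *+ i) (x + v *+ i.+1) <= b) ->
  exists p, [/\ path neighbour x p, last x p = x + v *+ n
              & path_cost c x p <= n%:R * b].
Proof.
move=> vE; elim: n x => [|n IH] x xb.
  by exists [::]; split; rewrite //= ?mulr0n ?addr0 // path_cost_nil mul0r.
case: (IH (x + v)) => [i|p [pp lp cp]].
  by move: (xb i.+1); rewrite -!addrA -!mulrS.
exists (x + v :: p); split.
- apply/andP; split=> //; rewrite /neighbour.
  change (x - (x + v) \in [:: e1; - e1; e2; - e2]); rewrite opprD addNKr.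
  by move: vE; rewrite !inE => /or4P[] /eqP ->; rewrite ?opprK eqxx ?orbT.
- by rewrite mulrS addrA -lp.
- rewrite path_cost_cons -natr1 mulrDl mul1r addrC lerD //.
  by move: (xb 0); rewrite mulr0n addr0 mulr1n.
Qed.

End Paths.

Section LayeredPaths.
Variables (R : realType) (Z : int -> R).

Local Notation omega := (layered_conductance Z).

Lemma edge_cost_vertical x y : x - y \in [:: e2; - e2] -> edge_cost omega x y = 1.
Proof. by move=> xy; rewrite /edge_cost /layered_conductance xy powR1 minxx. Qed.

Lemma edge_cost_horizontal x y : 1 <= Z x.2 -> x - y \in [:: e1; - e1] ->
  edge_cost omega x y = Z x.2 `^ (- 2^-1).
Proof.
move=> Z1 xy; rewrite /edge_cost /layered_conductance xy.
rewrite ifN; last first.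
  by move: xy; rewrite !inE => /orP[] /eqP ->.
apply/min_idPr; rewrite powRN invf_le1 ?powR_gt0 ?(lt_le_trans ltr01)//.
by rewrite -[leLHS](powRr0 (Z x.2)) ler_powR // invr_ge0 ler0n.
Qed.

Lemma neighbourP x y : neighbour x y ->
  x - y \in [:: e1; - e1] \/ x - y \in [:: e2; - e2].
Proof.
move=> xy; have : x - y \in [:: e1; - e1] ++ [:: e2; - e2] by exact: xy.
by rewrite mem_cat => /orP.
Qed.

(** Every unit of height is gained by a vertical edge, of cost 1. *)
Lemma path_cost_ge_height x p z : path neighbour x p -> z \in x :: p ->
  `|z.2 - x.2|%:~R <= path_cost omega x p.
Proof.
elim: p x => [|y p IH] x /=.
  by rewrite inE => _ /eqP ->; rewrite subrr normr0 path_cost_nil.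
move=> /andP[xy yp]; rewrite inE => /orP[/eqP ->|zp].
  by rewrite subrr normr0 path_cost_ge0.
rewrite path_cost_cons.
have := IH _ yp zp; set C := path_cost _ _ _ => zC.
have : `|z.2 - x.2|%:~R <= (`|y.2 - x.2|%:~R + `|z.2 - y.2|%:~R : R).
  by rewrite -intrD ler_int; lia.
have : `|y.2 - x.2|%:~R <= edge_cost omega x y; last lra.
case: (neighbourP xy) => [h|v].
  suff -> : y.2 - x.2 = 0 by rewrite normr0 edge_cost_ge0.
  by move: h; rewrite !inE => /orP[] /eqP[]; lia.
rewrite edge_cost_vertical // -[leRHS]/(1%:~R) ler_int.
by move: v; rewrite !inE => /orP[] /eqP[]; lia.
Qed.

(** Horizontal progress is made along edges of the layers that the path visits,
    and X bounds the conductances of all of them. *)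
Lemma path_cost_ge_width (K : int) (X : R) x p :
  (forall k, 1 <= Z k) -> (forall k : int, `|k| <= K -> Z k <= X) ->
  path neighbour x p -> (forall z, z \in x :: p -> `|z.2| <= K) ->
  `|(last x p).1 - x.1|%:~R * X `^ (- 2^-1) <= path_cost omega x p.
Proof.
move=> Z1 ZX; elim: p x => [|y p IH] x /=.
  by rewrite subrr normr0 mul0r path_cost_nil.
move=> /andP[xy yp] pK; rewrite path_cost_cons.
have := IH _ yp (fun z zp => pK z (mem_behead (s := x :: _) zp)).
set C := path_cost _ _ _; set X' := X `^ _; set l := (last y p).1 => lC.
have X'0 : 0 <= X' by exact: powR_ge0.
have : `|l - x.1|%:~R * X' <= (`|y.1 - x.1|%:~R + `|l - y.1|%:~R) * X'.
  by rewrite ler_wpM2r // -intrD ler_int; lia.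
rewrite mulrDl.
suff : `|y.1 - x.1|%:~R * X' <= edge_cost omega x y by lra.
case: (neighbourP xy) => [h|v]; last first.
  suff -> : y.1 - x.1 = 0 by rewrite normr0 mul0r edge_cost_ge0.
  by move: v; rewrite !inE => /orP[] /eqP[]; lia.
have -> : `|y.1 - x.1| = 1.
  by move: h; rewrite !inE => /orP[] /eqP[]; lia.
rewrite mul1r edge_cost_horizontal // /X' !powRN.
have Zx := Z1 x.2; have ZxX : Z x.2 <= X by apply: ZX; apply: pK; rewrite mem_head.
rewrite lef_pV2 ?posrE ?powR_gt0 ?ge0_ler_powR ?nnegrE //; lra.
Qed.

(** The path that climbs to layer k, follows it for L steps and comes down. *)
Lemma chemical_distance_le_layer L k : 1 <= Z k%:Z ->
  chemical_distance omega 0 (e1 *+ L) <= k%:R *+ 2 + L%:R * Z k%:Z `^ (- 2^-1).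
Proof.
move=> Z1.
have e2E i : e2 *+ i = (0, i%:Z) by elim: i => // i IH; rewrite mulrS IH; congr pair; lia.
have e1E i : e1 *+ i = (i%:Z, 0) by elim: i => // i IH; rewrite mulrS IH; congr pair; lia.
have [|p1 [pp1 lp1 cp1]] := @straight_path _ omega e2 1 k 0 isT.
  move=> i; rewrite edge_cost_vertical // !add0r mulrSr opprD addNKr.
  by rewrite !inE eqxx orbT.
have [|p2 [pp2 lp2 cp2]] :=
    @straight_path _ omega e1 (Z k%:Z `^ (- 2^-1)) L (e2 *+ k) isT.
  move=> i; rewrite edge_cost_horizontal.
  - by rewrite e1E e2E /= addr0.
  - by rewrite e1E e2E /= addr0.
  - by rewrite mulrSr addrA opprD addNKr !inE eqxx orbT.
have [|p3 [pp3 lp3 cp3]] := @straight_path _ omega (- e2) 1 k (e2 *+ k + e1 *+ L) isT.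
  move=> i; rewrite edge_cost_vertical // mulrSr addrA opprD addNKr.
  by rewrite !inE opprK eqxx.
rewrite add0r in lp1.
apply: le_trans (@chemical_distance_le _ _ _ _ (p1 ++ p2 ++ p3) _ _) _.
- by rewrite !cat_path pp1 lp1 pp2 lp2 pp3.
- by rewrite !last_cat lp1 lp2 lp3 mulNrn addrAC subrr add0r.
- rewrite !path_cost_cat lp1 lp2; lra.
Qed.

(** Either the path leaves the strip of height K, and pays K for the climb, or
    it stays there and pays for L horizontal steps in the strip. *)
Lemma chemical_distance_ge_layers L (K : nat) (X : R) :
  (forall k, 1 <= Z k) -> (forall k : int, `|k| <= K%:Z -> Z k <= X) ->
  Num.min K%:R (L%:R * X `^ (- 2^-1)) <= chemical_distance omega 0 (e1 *+ L).
Proof.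
move=> Z1 ZX; apply: lb_le_inf.
  have [|p [pp lp _]] := @straight_path _ omega e1 1 L 0 isT.
    by move=> i; rewrite ge_min lexx.
  by exists (path_cost omega 0 p), p => //; split=> //; rewrite lp add0r.
move=> _ [p [pp lp] <-]; rewrite ge_min.
have [/allP pK|/allPn[z zp]] := boolP (all (fun z => `|z.2| <= K%:Z) (0 :: p)).
  apply/orP; right.
  have := path_cost_ge_width Z1 ZX pp pK; rewrite lp subr0.
  suff -> : `|(e1 *+ L).1|%:~R = L%:R :> R by [].
  suff -> : e1 *+ L = (L%:Z, 0) by [].
  by elim: (L) => // i IH; rewrite mulrS IH; congr pair; lia.
rewrite -ltNge => Kz; apply/orP; left.
apply: le_trans (path_cost_ge_height pp zp).
by rewrite subr0 -[K%:R]/(K%:Z%:~R) ler_int ltW.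
Qed.

End LayeredPaths.

(** * Summable series *)

Section Series.
Variable R : realType.

(** With t = n / (n+1) this is the inequality 1 + delta (1 - t) <= t^(-delta),
    which follows from ln t <= t - 1 and 1 + x <= exp x. *)
Lemma powR_telescope (delta : R) (n : nat) : 0 < delta -> (0 < n)%N ->
  delta * n.+1%:R `^ (- (1 + delta)) <= n%:R `^ (- delta) - n.+1%:R `^ (- delta).
Proof.
move=> d0 n0; have n0' : 0 < n%:R :> R by rewrite ltr0n.
have n1' : 0 < n.+1%:R :> R by rewrite ltr0n.
set u := n.+1%:R `^ (- delta).
pose t : R := n%:R / n.+1%:R.
have t0 : 0 < t by rewrite divr_gt0.
have -> : n%:R `^ (- delta) = u * t `^ (- delta).
  by rewrite /u -powRM ?ltW // mulrC divfK ?gt_eqF.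
have -> : n.+1%:R `^ (- (1 + delta)) = u * n.+1%:R^-1.
  rewrite (_ : - (1 + delta) = - delta + -1); last by ring.
  rewrite powRD; last by rewrite (lt0r_neq0 n1') implybT.
  by rewrite powR_inv1 // ltW.
suff : 1 + delta * n.+1%:R^-1 <= t `^ (- delta).
  move=> /(ler_wpM2l (powR_ge0 n.+1%:R (- delta))); rewrite -/u mulrDr mulr1.
  by rewrite lerBrDr mulrCA addrC.
rewrite /powR gt_eqF //; apply: le_trans (expR_ge1Dx _); rewrite lerD2l.
rewrite mulNr -mulrN ler_pM2l // lerNr.
have -> : t = 1 + - n.+1%:R^-1.
  by rewrite /t -[n%:R](addrK 1) natr1 mulrBl divff ?gt_eqF // mul1r.
by apply: le_ln1Dx; rewrite ltrN2 invf_lt1 // ltr1n.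
Qed.

Lemma sum_powR_le (delta : R) (m N : nat) : 0 < delta -> (1 < m)%N ->
  \sum_(m <= n < N) n%:R `^ (- (1 + delta)) <= delta^-1 :> R.
Proof.
move=> d0; case: m => [//|m] m0.
have [Nm|mN] := leqP N m.+1; first by rewrite big_geq // invr_ge0 ltW.
case: N mN => // N mN.
rewrite -[leLHS](mulKf (lt0r_neq0 d0)) -[leRHS]mulr1 ler_pM2l ?invr_gt0 //.
rewrite mulr_sumr big_add1 /=.
apply: (@le_trans _ _ (\sum_(m <= i < N) (- i.+1%:R `^ (- delta) - - i%:R `^ (- delta)))).
  rewrite !big_nat; apply: ler_sum => i /andP[mi _].
  by rewrite opprK [leRHS]addrC powR_telescope // (leq_trans _ mi).
rewrite (telescope_sumr_eq (fun i => - (i%:R `^ (- delta)))) //; last by rewrite ltnW.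
rewrite opprK addrC lerBlDr -[leLHS]addr0 lerD ?powR_ge0 //.
rewrite powRN invf_le1 ?powR_gt0 ?ltr0n //.
by rewrite -[leLHS](powRr0 m%:R) ler_powR ?ler1n // ltW.
Qed.

(** exp x dominates x^(j+1) / (j+1)!, and the power j + 1 of n^delta reaches
    n^(1+delta) once delta (j+1) >= 1 + delta. Hence both families of rare
    events can be compared with the same series. *)
Lemma expRN_powR_le (delta : R) : 0 < delta ->
  exists2 C : R, 0 < C & forall n : nat, (0 < n)%N ->
    expR (- (n%:R `^ delta)) <= C * n%:R `^ (- (1 + delta)).
Proof.
move=> d0; pose j := Num.truncn ((1 + delta) / delta).
have jd : 1 + delta <= delta * j.+1%:R.
  by rewrite mulrC -ler_pdivrMr // ltW // truncnS_gt.
exists (j.+1)`!%:R; first by rewrite ltr0n fact_gt0.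
move=> n n0; have n1 : 1 <= n%:R :> R by rewrite ler1n.
rewrite expRN powRN -ler_pdivrMl ?invr_gt0 ?ltr0n ?fact_gt0 //.
rewrite -invfM lef_pV2 ?posrE ?mulr_gt0 ?powR_gt0 ?expR_gt0 ?ltr0n ?fact_gt0 //.
have x0 : 0 <= n%:R `^ delta by exact: powR_ge0.
apply: le_trans (_ : n%:R `^ delta ^+ j.+1 <= _); last first.
  rewrite -ler_pdivrMl ?ltr0n ?fact_gt0 // mulrC.
  apply: le_trans (expR_ge1Dxn j x0); lra.
by rewrite -powR_mulrn // -powRrM ler_powR.
Qed.

End Series.

(** * Rare events for identically distributed layers *)

Section Probability.
Context d (T : measurableType d) (R : realType) (P : probability T R).

(** Borel-Cantelli with the convergent series of n^(-(1+delta)). The bounds are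
    asked for from some rank on, because the tail is prescribed only at high
    levels. *)
Lemma ae_eventually_notin (A : (set T)^nat) (C delta : R) (n1 : nat) :
  0 < delta ->
  (forall n, (n1 <= n)%N ->
    measurable (A n) /\ (P (A n) <= (C * n%:R `^ (- (1 + delta)))%:E)%E) ->
  {ae P, forall w, exists n0, forall n, (n0 <= n)%N -> ~ A n w}.
Proof.
move=> d0 hA; pose m := maxn n1 2.
(* Shifting by m >= 2 also avoids the terms n = 0 and n = 1 of the series. *)
have mA k : measurable (A (k + m)%N).
  by apply: (hA _ _).1; rewrite (leq_trans (leq_maxl _ 2)) ?leq_addl.
have PA n : (n1 <= n)%N -> (P (A n) <= (C * n%:R `^ (- (1 + delta)))%:E)%E.
  by move=> /hA[].
have C0 : 0 <= C.
  have := le_trans (measure_ge0 P _) (PA m (leq_maxl _ _)).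
  by rewrite lee_fin pmulr_lge0 // powR_gt0 // ltr0n leq_max orbT.
have io0 : P (lim_sup_set (fun k => A (k + m)%N)) = 0.
  apply: lim_sup_set_cvg0 => //.
  apply: (@le_lt_trans _ _ (C * delta^-1)%:E); last exact: ltry.
  apply: lime_le; first exact: is_cvg_nneseries.
  apply: nearW => N.
  apply: (@le_trans _ _ (\sum_(0 <= k < N) (C * (k + m)%:R `^ (- (1 + delta)))%:E)%E).
    by apply: lee_sum => k _; apply: PA; rewrite (leq_trans (leq_maxl _ 2)) ?leq_addl.
  rewrite sumEFin lee_fin -mulr_sumr ler_wpM2l //.
  apply: le_trans (@sum_powR_le _ delta m (N + m) d0 (leq_maxr _ _)).
  by rewrite -{2}[m]add0n big_addn addnK.
exists (lim_sup_set (fun k => A (k + m)%N)); split => //.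
  by apply: bigcap_measurable => // k _; apply: bigcup_measurable => j _; exact: mA.
move=> w /= /forallNP hw n _.
have /existsNP[k /not_implyP[nk /contrapT Ak]] := hw (n + m)%N.
have mk : (m <= k)%N by exact: leq_trans (leq_addl _ _) nk.
exists (k - m)%N; first by rewrite /= -(leq_add2r m) subnK.
by rewrite subnK.
Qed.

Variable Z : int -> {RV P >-> R}.

Lemma measurable_tail k t : measurable [set w | t < Z k w].
Proof.
by rewrite -[X in measurable X]setTI -preimage_itvoy; apply: measurable_funP.
Qed.

Lemma tail_identical (k j : int) (t : R) : identically_distributed Z ->
  P [set w | t < Z k w] = P [set w | t < Z j w].
Proof. by move=> Zid; rewrite -!preimage_itvoy; exact: Zid. Qed.

(** Union bound over the 2 m + 1 layers of height at most m. *)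
Lemma exists_tail_le (m : nat) (t p : R) :
  (forall k, P [set w | t < Z k w] = p%:E) ->
  let A := [set w | exists k : int, `|k| <= m%:Z /\ t < Z k w] in
  measurable A /\ (P A <= ((m.*2.+1)%:R * p)%:E)%E.
Proof.
move=> tail A.
pose B i := [set w | t < Z (i%:Z - m%:Z) w].
have -> : A = \big[setU/set0]_(i < m.*2.+1) B i.
  rewrite -bigcup_mkord; apply/seteqP; split => w /=.
    move=> [k [km tk]]; exists (absz (k + m%:Z)); first by rewrite /=; lia.
    by rewrite /B/=; have -> : (absz (k + m%:Z))%:Z - m%:Z = k by lia.
  by move=> [i /= im ti]; exists (i%:Z - m%:Z); split=> //; lia.
split; first by apply: bigsetU_measurable => i _; exact: measurable_tail.
apply: le_trans (Boole_inequality _ _) _; first by move=> i _; exact: measurable_tail.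
rewrite (eq_bigr (fun=> p%:E)); last by move=> i _; exact: tail.
by rewrite sumEFin lee_fin sumr_const card_ord mulr_natl.
Qed.

Lemma forall_tail_le (m : nat) (t p : R) :
  mutually_independent Z -> (forall k, P [set w | t < Z k w] = p%:E) ->
  let A := [set w | forall k, (0 < k <= m)%N -> Z k%:Z w <= t] in
  measurable A /\ P A = ((1 - p) ^+ m)%:E.
Proof.
move=> Zind tail A.
pose s := [seq Posz i.+1 | i <- iota 0 m].
have AE : A = \bigcap_(i in [set` [fset x in s]%fset]) (Z i @^-1` `]-oo, t]).
  apply/seteqP; split => w /=.
    move=> Aw i /=; rewrite inE => /mapP[k]; rewrite mem_iota => km ->.
    by rewrite in_itv /= Aw.
  move=> Bw [//|k] km; have := Bw k.+1.
  rewrite /= in_itv /=; apply; rewrite inE; apply/mapP; exists k => //.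
  by rewrite mem_iota.
have mZ i : measurable (Z i @^-1` `]-oo, t]).
  by rewrite -[X in measurable X]setTI; apply: measurable_funP.
split; first by rewrite AE; apply: fin_bigcap_measurable => //; exact: finite_fset.
rewrite AE (Zind _ (fun=> [set` `]-oo, t]])) //.
have PZ i : P (Z i @^-1` `]-oo, t]) = (1 - p)%:E.
  have -> : Z i @^-1` `]-oo, t] = ~` [set w | t < Z i w].
    apply/seteqP; split => w /=; rewrite in_itv /=; first by rewrite leNgt => /negP.
    by move=> /negP; rewrite -leNgt.
  by rewrite probability_setC ?tail //; exact: measurable_tail.
rewrite (eq_bigr (fun=> (1 - p)%:E)); last by move=> i _; exact: PZ.
rewrite prodEFin big_const_seq count_predT.
have -> : size [fset x in s]%fset = m.
  rewrite card_fseq undup_id ?size_map ?size_iota //.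
  by rewrite map_inj_uniq ?iota_uniq // => i j [].
by rewrite iter_mulr_1.
Qed.

End Probability.

(** * Dyadic scales *)

Lemma sqr_le_exp2 n : (4 <= n)%N -> (n * n <= 2 ^ n)%N.
Proof.
elim: n => // n IH; rewrite leq_eqVlt => /orP[/eqP <- //|]; rewrite ltnS => n4.
by have := IH n4; rewrite expnS; nia.
Qed.

Section Dyadic.
Variable R : realType.

Lemma natr_div_exp2_small (p : R) : 0 < p ->
  exists n1, forall n, (n1 <= n)%N -> n%:R / 2 ^+ n <= p.
Proof.
move=> p0; exists (maxn 4 (Num.truncn p^-1).+1) => n.
rewrite geq_max => /andP[n4 pn].
have n0 : 0 < n%:R :> R by rewrite ltr0n (leq_trans _ n4).
have np : n%:R^-1 <= p.
  rewrite invf_ple ?posrE // ltW // (lt_le_trans (truncnS_gt _)) // ler_nat//.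
apply: le_trans np; rewrite ler_pdivrMr ?exprn_gt0 // mulrC ler_pdivlMr //.
by rewrite -natrM -natrX ler_nat sqr_le_exp2.
Qed.

Lemma dyadic_scale (x : R) : 1 <= x -> exists n, 2 ^+ n <= x < 2 ^+ n.+1.
Proof.
move=> x1; have t0 : (0 < Num.truncn x)%N by rewrite truncn_gt0.
have /andP[lo hi] := trunc_log_bounds (isT : 1 < 2)%N t0.
exists (trunc_log 2 (Num.truncn x)); rewrite -!natrX; apply/andP; split.
  by rewrite -truncn_ge_nat ?(le_trans ler01).
by rewrite -truncn_lt_nat ?(le_trans ler01).
Qed.

(** The constant 2 comes from ln 2 >= 1/2, itself ln (1/2) <= - 1/2. *)
Lemma dyadic_exponent_le_ln (x : R) n : 2 ^+ n <= x -> n%:R <= 2 * ln x.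
Proof.
move=> nx; have n0 : 0 < 2 ^+ n :> R by rewrite exprn_gt0.
have : ln (2 ^+ n) <= ln x by rewrite ler_ln ?posrE ?(lt_le_trans n0).
rewrite lnXn // -[ln 2 *+ n]mulr_natl.
have : ln (1 + - (2^-1)) <= - (2^-1) :> R by apply: le_ln1Dx; rewrite ltrN2; lra.
have -> : 1 + - 2^-1 = 2^-1 :> R by lra.
rewrite lnV ?posrE // => l2 nl.
have : 0 <= n%:R * (ln 2 - 2^-1) :> R.
  by rewrite mulr_ge0 // subr_ge0; lra.
rewrite mulrBr; lra.
Qed.

(** With l = ln L, one has L^gamma = exp (gamma l) >= (gamma l)^2 / 2 while
    l^(-beta) >= 1 / l, so the product is at least gamma^2 l / 2. *)
Lemma powR_dominates_ln (gamma beta K : R) : 0 < gamma -> beta <= 1 ->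
  exists L0 : nat, forall L : nat, (L0 <= L)%N ->
    [/\ (0 < L)%N, 1 <= ln L%:R :> R & K <= L%:R `^ gamma * ln L%:R `^ (- beta)].
Proof.
move=> g0 b1; pose K' := Num.max 1 (2 * K / gamma ^+ 2).
exists (Num.truncn (expR K')).+1 => L L0L.
have L0 : (0 < L)%N by exact: leq_trans L0L.
have L0' : 0 < L%:R :> R by rewrite ltr0n.
have : K' <= ln L%:R.
  rewrite -[K']expRK ler_ln ?posrE ?expR_gt0 // ltW // (lt_le_trans (truncnS_gt _)) //.
  by rewrite ler_nat.
set l := ln _; rewrite ge_max => /andP[l1 lK]; split => //.
have l0 : 0 < l by lra.
apply: le_trans (_ : L%:R `^ gamma * l^-1 <= _); last first.
  by rewrite ler_wpM2l ?powR_ge0 // -powR_inv1 ?(ltW l0) // ler_powR // lerN2.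
rewrite ler_pdivlMr // /powR gt_eqF // -/l.
have gl : 0 <= gamma * l by rewrite mulr_ge0 // ltW.
apply: le_trans (expR_ge1Dxn 1 gl).
rewrite ler_pdivrMr ?exprn_gt0 // in lK.
have := ler_wpM2r (ltW l0) lK; rewrite (_ : 2`! = 2%N) // exprMn; lra.
Qed.

End Dyadic.

(** * Almost sure size of the maxima over dyadic strips *)

Section Quantiles.
Variable R : realType.

(** The level exceeded with probability p under the tail (a u)^(-alpha). *)
Definition quantile (a alpha p : R) : R := a^-1 * p `^ (- alpha^-1).

Lemma quantile_gt0 a alpha p : 0 < a -> 0 < p -> 0 < quantile a alpha p.
Proof. by move=> a0 p0; rewrite mulr_gt0 ?invr_gt0 ?powR_gt0. Qed.

Lemma quantileK a alpha p : 0 < a -> 0 < alpha -> 0 < p ->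
  (a * quantile a alpha p) `^ (- alpha) = p.
Proof.
move=> a0 al0 p0; rewrite /quantile mulVKf ?gt_eqF // -powRrM mulrNN mulVf ?gt_eqF //.
by rewrite powRr1 // ltW.
Qed.

Lemma quantile_ge a alpha p u : 0 < a -> 0 < alpha -> 0 < u -> 0 < p ->
  p <= (a * u) `^ (- alpha) -> u <= quantile a alpha p.
Proof.
move=> a0 al0 u0 p0 pu; have au0 : 0 < a * u by exact: mulr_gt0.
rewrite /quantile ler_pdivlMl // powRN -[leLHS]invrK.
rewrite lef_pV2 ?posrE ?invr_gt0 ?powR_gt0 // -[(a * u)^-1]powR_inv1 ?(ltW au0) //.
have -> : -1 = - alpha * alpha^-1 by rewrite mulNr mulfV ?gt_eqF.
by rewrite powRrM ge0_ler_powR ?nnegrE ?invr_ge0 ?powR_ge0 // ltW.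
Qed.

Lemma quantile_powR_Nhalf a alpha p : 0 < a -> 0 < alpha -> 0 < p ->
  quantile a alpha p `^ (- 2^-1) = a `^ 2^-1 * p `^ (2 * alpha)^-1.
Proof.
move=> a0 al0 p0; rewrite /quantile powRM ?invr_ge0 ?powR_ge0 ?(ltW a0) //.
rewrite -powR_inv1 ?(ltW a0) // -!powRrM mulN1r opprK mulrNN; congr (_ * _ `^ _).
by rewrite invfM mulrC.
Qed.

End Quantiles.

Section Maxima.
Context d (T : measurableType d) (R : realType) (P : probability T R).
Variable Z : int -> {RV P >-> R}.

(** The factors n^(1+delta) and n^delta are what makes the two probabilities
    summable in n. As n has the order of ln L at the relevant scale, they turn
    into the powers of ln L in the bounds on the distance. *)
Lemma dyadic_maxima (delta p0 : R) (thr : R -> R) :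
  mutually_independent Z -> 0 < delta -> delta <= 1 -> 0 < p0 ->
  (forall p, 0 < p -> p <= p0 -> forall k, P [set w | thr p < Z k w] = p%:E) ->
  {ae P, forall w, exists n0, forall n, (n0 <= n)%N ->
    (forall k : int, `|k| <= (2 ^ n)%N%:Z ->
       Z k w <= thr ((2 ^+ n * n%:R `^ (1 + delta))^-1)) /\
    (exists2 k : nat, (k <= 2 ^ n)%N & thr (n%:R `^ delta / 2 ^+ n) < Z k%:Z w)}.
Proof.
move=> Zind d0 d1 p00 tail.
have [n1 n1P] := natr_div_exp2_small p00.
pose hi n : R := (2 ^+ n * n%:R `^ (1 + delta))^-1.
pose lo n : R := n%:R `^ delta / 2 ^+ n.
have e0 n : 0 < 2 ^+ n :> R by rewrite exprn_gt0.
have loP n : (maxn 1 n1 <= n)%N -> 0 < lo n <= p0.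
  rewrite geq_max => /andP[n0 nn1]; rewrite divr_gt0 ?powR_gt0 ?ltr0n //=.
  apply: le_trans (n1P n nn1); rewrite ler_pM2r ?invr_gt0 //.
  by rewrite ler1_powR ?ler1n.
have hiP n : (maxn 1 n1 <= n)%N -> 0 < hi n <= p0.
  move=> nn; have /andP[lo0 lop] := loP n nn; move: nn; rewrite geq_max => /andP[n0 _].
  have n1' : 1 <= n%:R :> R by rewrite ler1n.
  rewrite invr_gt0 mulr_gt0 ?powR_gt0 ?ltr0n //=.
  apply: le_trans lop; rewrite /hi /lo invfM mulrC ler_pM2r ?invr_gt0 //.
  apply: le_trans (_ : 1 <= _).
    rewrite invf_le1 ?powR_gt0 ?ltr0n //.
    by rewrite -[leLHS](powRr0 n%:R) ler_powR // addr_ge0 // ltW.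
  by rewrite -[leLHS](powRr0 n%:R) ler_powR // ltW.
have [C C0 CP] := expRN_powR_le d0.
have aehi : {ae P, forall w, exists n0, forall n, (n0 <= n)%N ->
    ~ exists k : int, `|k| <= (2 ^ n)%N%:Z /\ thr (hi n) < Z k w}.
  apply: (@ae_eventually_notin _ _ _ P
    (fun n => [set w | exists k : int, `|k| <= (2 ^ n)%N%:Z /\ thr (hi n) < Z k w])
    3 delta (maxn 1 n1) d0) => n nn.
  have /andP[h0 hp] := hiP n nn.
  have [mA PA] := exists_tail_le (2 ^ n) (tail _ h0 hp); split => //.
  apply: le_trans PA _; rewrite lee_fin /hi invfM mulrA powRN ler_wpM2r ?invr_ge0 ?powR_ge0 //.
  rewrite ler_pdivrMr // -natrX -natrM ler_nat.
  by have := expn_gt0 2 n; lia.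
have aelo : {ae P, forall w, exists n0, forall n, (n0 <= n)%N ->
    ~ forall k, (0 < k <= 2 ^ n)%N -> Z k%:Z w <= thr (lo n)}.
  apply: (@ae_eventually_notin _ _ _ P
    (fun n => [set w | forall k, (0 < k <= 2 ^ n)%N -> Z k%:Z w <= thr (lo n)])
    C delta (maxn 1 n1) d0) => n nn.
  have /andP[h0 hp] := loP n nn.
  have [mA PA] := forall_tail_le (2 ^ n) Zind (tail _ h0 hp); split => //.
  rewrite PA lee_fin; apply: le_trans (CP n _); last by move: nn; rewrite geq_max => /andP[].
  have p1 : lo n <= 1.
    by rewrite -lee_fin -(tail _ h0 hp 0); exact: probability_le1 (measurable_tail _ _ _).
  apply: (@le_trans _ _ (expR (- lo n) ^+ (2 ^ n))).
    by apply: lerXn2r; rewrite ?nnegrE ?subr_ge0 ?expR_ge0 // expR_ge1Dx.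
  by rewrite -expRM_natl natrX mulrN /lo mulrC divfK ?gt_eqF.
apply: filterS2 aehi aelo => w [n2 hn2] [n3 hn3]; exists (maxn n2 n3) => n.
rewrite geq_max => /andP[nn2 nn3]; split.
  move=> k km; rewrite leNgt; apply/negP => kt; apply: (hn2 n nn2); by exists k.
apply: contrapT => no; apply: (hn3 n nn3) => k /andP[_ km].
by rewrite leNgt; apply/negP => kt; apply: no; exists k.
Qed.

End Maxima.

(** * Balancing climb and traversal *)

(** Here q stands for 1 / (2 alpha), so that L = s s^q, l for ln L, m for the
    height 2^n and r for n; B p^q is the cost of a horizontal step at the level
    of tail probability p. *)
Section Scale.
Variables (R : realType) (q delta B s l m r : R).
Hypotheses (q0 : 0 < q) (delta0 : 0 < delta) (B0 : 0 <= B) (s0 : 0 < s)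
  (l1 : 1 <= l) (m0 : 0 < m) (r0 : 0 < r) (rl : r <= 2 * l).

Let l0 : 0 < l. Proof. exact: lt_le_trans l1. Qed.

Lemma balance_upper : m <= s < 2 * m ->
  m *+ 2 + s * s `^ q * (B * (r `^ delta / m) `^ q) <=
  (2 + B * 2 `^ ((1 + delta) * q)) * l `^ (delta * q) * s.
Proof.
move=> /andP[ms sm].
have lq1 : 1 <= l `^ (delta * q).
  by rewrite -[leLHS](powRr0 l) ler_powR // mulr_ge0 // ltW.
have rmE : (r `^ delta / m) `^ q <= 2 `^ ((1 + delta) * q) * l `^ (delta * q) / s `^ q.
  apply: (@le_trans _ _ (((2 * l) `^ delta * (2 / s)) `^ q)).
    rewrite ge0_ler_powR ?nnegrE ?mulr_ge0 ?powR_ge0 ?invr_ge0 ?(ltW q0) ?(ltW m0) ?(ltW s0) //.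
    rewrite ler_pM ?powR_ge0 ?invr_ge0 ?(ltW m0) //.
      by rewrite ge0_ler_powR ?nnegrE ?mulr_ge0 ?(ltW l0) ?(ltW r0) ?(ltW delta0).
    by rewrite ler_pdivlMr // mulrC ler_pdivrMr // ltW.
  rewrite !powRM ?mulr_ge0 ?powR_ge0 ?invr_ge0 ?(ltW l0) ?(ltW s0) //.
  rewrite -!powRrM mulrDl mul1r powRD ?pnatr_eq0 ?implybT //.
  rewrite -[s^-1]powR_inv1 ?(ltW s0) // -powRrM mulN1r powRN; lra.
have sq0 : 0 < s `^ q by exact: powR_gt0.
have : s * s `^ q * (B * (r `^ delta / m) `^ q) <=
    B * 2 `^ ((1 + delta) * q) * l `^ (delta * q) * s.
  apply: (@le_trans _ _
    (s * s `^ q * (B * (2 `^ ((1 + delta) * q) * l `^ (delta * q) / s `^ q)))).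
    by rewrite ler_wpM2l ?ler_wpM2l // mulr_ge0 ?ltW.
  by rewrite le_eqVlt; apply/orP; left; apply/eqP; field; rewrite gt_eqF.
have : m *+ 2 <= 2 * l `^ (delta * q) * s by nra.
lra.
Qed.

(** The exponent beta solves beta (1 + q) = (1 + delta) q because it makes the
    cost s l^(-beta) of the climb equal, up to constants, to the cost
    s s^q (s l^(-beta) l^(1+delta))^(-q) = s l^(-q (1 + delta - beta)) of the
    traversal. *)
Lemma balance_lower (beta : R) : beta * (1 + q) = (1 + delta) * q ->
  m <= s * l `^ (- beta) < 2 * m ->
  Num.min 2^-1 (B * 2 `^ (- ((1 + delta) * q))) * l `^ (- beta) * s <=
  Num.min m (s * s `^ q * (B * (m * r `^ (1 + delta))^-1 `^ q)).
Proof.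
move=> betaE /andP[ms sm]; set c := Num.min _ _.
have lb0 : 0 < l `^ (- beta) by exact: powR_gt0.
have sq0 : 0 < s `^ q by exact: powR_gt0.
have ls0 : 0 < l `^ (- beta) * s by exact: mulr_gt0.
rewrite le_min; apply/andP; split.
  have : c * (l `^ (- beta) * s) <= 2^-1 * (l `^ (- beta) * s).
    by rewrite ler_pM2r // ge_min lexx.
  lra.
have hc : c * l `^ (- beta) * s <= B * 2 `^ (- ((1 + delta) * q)) * (l `^ (- beta) * s).
  by rewrite -mulrA ler_pM2r // ge_min lexx orbT.
apply: le_trans hc _.
pose Y := s * l `^ (- beta) * (2 * l) `^ (1 + delta).
have Y0 : 0 < Y by rewrite !mulr_gt0 ?powR_gt0 ?mulr_gt0.
have mrY : m * r `^ (1 + delta) <= Y.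
  rewrite ler_pM ?powR_ge0 ?(ltW m0) // ge0_ler_powR ?nnegrE ?mulr_ge0 //.
  - by rewrite addr_ge0 ?(ltW delta0).
  - exact: ltW r0.
  - exact: ltW l0.
have : Y^-1 `^ q <= (m * r `^ (1 + delta))^-1 `^ q.
  rewrite ge0_ler_powR ?nnegrE ?invr_ge0 ?(ltW Y0) ?(ltW q0) //.
    by rewrite mulr_ge0 ?powR_ge0 ?(ltW m0).
  by rewrite lef_pV2 ?posrE // mulr_gt0 ?powR_gt0.
have -> : Y^-1 `^ q = 2 `^ (- ((1 + delta) * q)) * l `^ (- beta) / s `^ q.
  rewrite -[Y^-1]powR_inv1 ?(ltW Y0) // powRAC powR_inv1 ?powR_ge0 // /Y.
  rewrite !powRM ?mulr_ge0 ?powR_ge0 ?(ltW s0) ?(ltW l0) //.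
  rewrite -!powRrM mulrACA.
  rewrite (mulrC (s `^ q)) mulrAC.
  have -> : l `^ (- beta * q) * l `^ ((1 + delta) * q) = l `^ beta.
    rewrite -powRD; last by rewrite (lt0r_neq0 l0) implybT.
    by congr (_ `^ _); rewrite -betaE; ring.
  by rewrite !powRN !invfM; ring.
move=> h; have := ler_wpM2l (mulr_ge0 (mulr_ge0 (ltW s0) (ltW sq0)) B0) h.
rewrite -[in X in _ <= X -> _]mulrA; apply: le_trans; rewrite le_eqVlt.
by apply/orP; left; apply/eqP; field; rewrite gt_eqF.
Qed.

End Scale.

Theorem lemma1p12 (R : realType) (d : measure_display) (T : measurableType d)
    (P : probability T R) (alpha : R) (Z : int -> {RV P >-> R})
    (alpha_gt1 : 1 < alpha)
    (Z_indep : mutually_independent Z)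
    (Z_ident : identically_distributed Z)
    (Z_ge1 : forall (k : int) (w : T), 1 <= Z k w)
    (Z_tail : exists a u0 : R, [/\ 0 < a, 0 < u0 &
       forall u : R, u0 <= u ->
         P [set w | u < Z 1 w] = ((a * u) `^ (- alpha))%:E])
    (delta : R) (delta_gt0 : 0 < delta) (delta_lt1 : delta < 1) :
  exists cZ CZ : R, [/\ 0 < cZ, cZ < CZ &
    {ae P, forall w : T, exists L0 : nat, forall L : nat, (L0 <= L)%N ->
      let D := chemical_distance (layered_conductance (fun k => Z k w))
                 0 (e1 *+ L) in
      cZ * ln L%:R `^ (- ((1 + delta) / (2 * alpha + 1)))
         * L%:R `^ (2 * alpha / (2 * alpha + 1)) <= D
      /\ D <= CZ * ln L%:R `^ (delta / (2 * alpha))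
         * L%:R `^ (2 * alpha / (2 * alpha + 1))}].
Proof.
have [a [u0 [a0 u00 tail1]]] := Z_tail.
have al0 : 0 < alpha by lra.
pose q := (2 * alpha)^-1; have q0 : 0 < q by rewrite invr_gt0; lra.
pose beta := (1 + delta) / (2 * alpha + 1).
pose gamma := 2 * alpha / (2 * alpha + 1).
pose B := a `^ 2^-1; have B0 : 0 < B by exact: powR_gt0.
have betaE : beta * (1 + q) = (1 + delta) * q by rewrite /beta /q; field; lra.
have gammaE : gamma + gamma * q = 1 by rewrite /gamma /q; field; lra.
have g0 : 0 < gamma by rewrite divr_gt0; lra.
have g1 : gamma <= 1 by rewrite ler_pdivrMr; lra.
have b0 : 0 < beta by rewrite divr_gt0; lra.
have b1 : beta <= 1 by rewrite ler_pdivrMr; lra.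
pose cZ := Num.min 2^-1 (B * 2 `^ (- ((1 + delta) * q))).
pose CZ := 2 + B * 2 `^ ((1 + delta) * q).
exists cZ, CZ; split.
- by rewrite lt_min invr_gt0 ltr0n /= mulr_gt0 ?powR_gt0.
- apply: (@le_lt_trans _ _ 2^-1); first by rewrite ge_min lexx.
  have : 0 < B * 2 `^ ((1 + delta) * q) by rewrite mulr_gt0 ?powR_gt0.
  by rewrite /CZ; lra.
have tail p : 0 < p -> p <= (a * u0) `^ (- alpha) ->
    forall k, P [set w | quantile a alpha p < Z k w] = p%:E.
  move=> p0 pu k; rewrite (tail_identical k 1 _ Z_ident) tail1 ?quantileK //.
  exact: quantile_ge.
have := dyadic_maxima Z_indep delta_gt0 (ltW delta_lt1)
  (powR_gt0 (- alpha) (mulr_gt0 a0 u00)) tail.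
apply: filterS => w [n0 hn0].
have [L0 hL0] := powR_dominates_ln (2 ^+ (maxn n0 1)) g0 b1.
exists L0 => L L0L.
have [Lpos l1 sK] := hL0 L L0L; rewrite -/beta in sK.
pose s := L%:R `^ gamma; rewrite -/s in sK.
set l := ln L%:R in l1 sK.
have L1 : 1 <= L%:R :> R by rewrite ler1n.
have s0 : 0 < s by rewrite powR_gt0 // ltr0n.
have LE : L%:R = s * s `^ q.
  rewrite /s -powRrM -powRD ?gammaE ?powRr1 // ?oner_eq0 //.
have sL : s <= L%:R by rewrite ler1_powR.
have sbs : s * l `^ (- beta) <= s.
  by rewrite ler_piMr ?(ltW s0) // -[leRHS](powRr0 l) ler_powR // oppr_le0 ltW.
(* Every x between the threshold 2^(max n0 1) and s is comparable to 2^n for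
   some n >= n0; it is used with x = s l^(-beta) and with x = s. *)
have scale x : 2 ^+ (maxn n0 1) <= x -> x <= s ->
    exists n, [/\ (n0 <= n)%N, 2 ^+ n <= x < 2 * 2 ^+ n, 0 < n%:R :> R & n%:R <= 2 * l].
  move=> Kx xs.
  have [|n /andP[nx xn]] := @dyadic_scale R x.
    by apply: le_trans Kx; rewrite exprn_ege1 // ler1n.
  have : (maxn n0 1 < n.+1)%N.
    by rewrite -(@ltr_eXn2l R 2) ?ltr1n //; exact: le_lt_trans xn.
  rewrite ltnS geq_max => /andP[nn0 n1].
  exists n; rewrite nx -exprS xn ltr0n; split => //.
  by apply: dyadic_exponent_le_ln; rewrite (le_trans nx) // (le_trans xs).
have qN p : 0 < p -> quantile a alpha p `^ (- 2^-1) = B * p `^ q.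
  by move=> p0; rewrite quantile_powR_Nhalf.
have e0 n : 0 < 2 ^+ n :> R by rewrite exprn_gt0.
rewrite -/beta -/gamma -/s -/l; split.
- have [n [nn0 nx n1 nl]] := scale _ sK sbs.
  have [hi _] := hn0 n nn0.
  apply: le_trans (chemical_distance_ge_layers L (Z_ge1^~ w) hi).
  rewrite natrX qN ?invr_gt0 ?mulr_gt0 ?powR_gt0 // LE.
  exact: (balance_lower q0 delta_gt0 (ltW B0) s0 l1 (e0 n) n1 nl betaE nx).
- have [n [nn0 nx n1 nl]] := scale _ (le_trans sK sbs) (lexx s).
  have [_ [k kn Zk]] := hn0 n nn0.
  have t0 : 0 < quantile a alpha (n%:R `^ delta / 2 ^+ n).
    by rewrite quantile_gt0 // divr_gt0 ?powR_gt0.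
  apply: le_trans (@chemical_distance_le_layer _ (fun k => Z k w) L k (Z_ge1 _ _)) _.
  apply: (@le_trans _ _ (2 ^+ n *+ 2 + s * s `^ q * (B * (n%:R `^ delta / 2 ^+ n) `^ q))).
    apply: lerD; first by rewrite lerMn2r -natrX ler_nat kn orbT.
    rewrite -LE ler_wpM2l // -qN ?divr_gt0 ?powR_gt0 //.
    have Z0 := lt_trans t0 Zk.
    rewrite !powRN lef_pV2 ?posrE ?powR_gt0 //.
    by rewrite ge0_ler_powR ?nnegrE ?invr_ge0 // ltW.
  exact: (balance_upper q0 delta_gt0 (ltW B0) s0 l1 (e0 n) n1 nl nx).
Qed.
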